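(* Let $n\ge 0$ be an integer. The electrical Lie algebra $\mathfrak{e}_{A_{2n+1}}$ is isomorphic, as a Lie algebra, to the odd symplectic Lie algebra $\mathfrak{sp}_{2n+1}$.
   Context: All Lie algebras are over $\mathbb{C}$. For $m\ge 1$, $\mathfrak{e}_{A_m}$ is the Lie algebra generated by $e_1,\dots,e_m$ subject to $[e_i,e_j]=0$ if $|i-j|\ge 2$ and $[e_i,[e_i,e_j]]=-2e_i$ if $|i-j|=1$. Let $\Omega=\begin{pmatrix}0&I_{n+1}\\-I_{n+1}&0\end{pmatrix}$ and $\mathfrak{sp}_{2n+2}=\{X\in\mathfrak{gl}_{2n+2}(\mathbb{C}): X^T\Omega+\Omega X=0\}$. Let $y_{n+1}$ be the $(n+1)$-th coordinate functional on $\mathbb{C}^{2n+2}$. The odd symplectic Lie algebra $\mathfrak{sp}_{2n+1}$ is the Lie algebra of the subgroup of $GL_{2n+2}(\mathbb{C})$ preserving both the bilinear form with matrix $\Omega$ and the functional $y_{n+1}$, i.e. $\mathfrak{sp}_{2n+1}=\{X\in\mathfrak{sp}_{2n+2}: y_{n+1}\circ X=0\}$ (the matrices in $\mathfrak{sp}_{2n+2}$ whose $(n+1)$-th row is zero). *)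

(* Defs.v *)
From HB Require Import structures.
From mathcomp Require Import all_boot all_order all_algebra.
From mathcomp Require Import ring boolp reals.
From mathcomp Require Export complex.

Set Implicit Arguments.
Unset Strict Implicit.
Unset Printing Implicit Defensive.

Import GRing.Theory.
Local Open Scope ring_scope.
Local Open Scope quotient_scope.

HB.mixin Record Lmodule_isLieAlgebra (K : fieldType) L of GRing.Lmodule K L := {
  lie_bracket : L -> L -> L;
  lie_linearl : forall (a : K) (x y z : L),
    lie_bracket (a *: x + y) z = a *: lie_bracket x z + lie_bracket y z;
  lie_linearr : forall (a : K) (x y z : L),
    lie_bracket z (a *: x + y) = a *: lie_bracket z x + lie_bracket z y;
  liexx : forall x : L, lie_bracket x x = 0;
  lie_jacobi : forall x y z : L,
    lie_bracket x (lie_bracket y z) + lie_bracket y (lie_bracket z x)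
      + lie_bracket z (lie_bracket x y) = 0
}.

#[short(type="lieAlgType")]
HB.structure Definition LieAlgebra (K : fieldType) :=
  { L of GRing.Lmodule K L & Lmodule_isLieAlgebra K L }.

Notation "[lie x , y ]" := (lie_bracket x y)
  (at level 0, x, y at level 99, format "[lie  x ,  y ]") : ring_scope.

Definition lie_morphism (K : fieldType) (L M : lieAlgType K) (f : L -> M) :=
  forall x y : L, f [lie x, y] = [lie f x, f y].

Definition lie_isomorphic (K : fieldType) (L M : lieAlgType K) : Prop :=
  exists f : {linear L -> M}, lie_morphism f /\ bijective f.

Inductive lie_term (K I : Type) : Type :=
| LGen of I
| LZero
| LAdd of lie_term K I & lie_term K I
| LOpp of lie_term K I
| LScale of K & lie_term K I
| LBr of lie_term K I & lie_term K I.

Arguments LGen {K I} i.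
Arguments LZero {K I}.

HB.instance Definition _ (K I : Type) := gen_eqMixin (lie_term K I).
HB.instance Definition _ (K I : Type) := gen_choiceMixin (lie_term K I).

(* The least congruence on Lie terms that contains [rel] and all instances of
   the Lie algebra axioms. *)
Inductive lie_cong (K : fieldType) (I : Type)
    (rel : lie_term K I -> lie_term K I -> Prop) :
    lie_term K I -> lie_term K I -> Prop :=
| LC_rel s t : rel s t -> lie_cong rel s t
| LC_refl s : lie_cong rel s s
| LC_sym s t : lie_cong rel s t -> lie_cong rel t s
| LC_trans s t u : lie_cong rel s t -> lie_cong rel t u -> lie_cong rel s u
| LC_add s s' t t' : lie_cong rel s s' -> lie_cong rel t t' ->
    lie_cong rel (LAdd s t) (LAdd s' t')
| LC_opp s s' : lie_cong rel s s' -> lie_cong rel (LOpp s) (LOpp s')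
| LC_scale a s s' : lie_cong rel s s' ->
    lie_cong rel (LScale a s) (LScale a s')
| LC_br s s' t t' : lie_cong rel s s' -> lie_cong rel t t' ->
    lie_cong rel (LBr s t) (LBr s' t')
| LC_addA s t u : lie_cong rel (LAdd s (LAdd t u)) (LAdd (LAdd s t) u)
| LC_addC s t : lie_cong rel (LAdd s t) (LAdd t s)
| LC_add0 s : lie_cong rel (LAdd LZero s) s
| LC_addN s : lie_cong rel (LAdd (LOpp s) s) LZero
| LC_scaleA a b s :
    lie_cong rel (LScale a (LScale b s)) (LScale (a * b) s)
| LC_scale1 s : lie_cong rel (LScale 1 s) s
| LC_scaleDr a s t :
    lie_cong rel (LScale a (LAdd s t)) (LAdd (LScale a s) (LScale a t))
| LC_scaleDl s a b :
    lie_cong rel (LScale (a + b) s) (LAdd (LScale a s) (LScale b s))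
| LC_brl a s t u : lie_cong rel (LBr (LAdd (LScale a s) t) u)
                                (LAdd (LScale a (LBr s u)) (LBr t u))
| LC_brr a s t u : lie_cong rel (LBr u (LAdd (LScale a s) t))
                                (LAdd (LScale a (LBr u s)) (LBr u t))
| LC_brxx s : lie_cong rel (LBr s s) LZero
| LC_jacobi s t u :
    lie_cong rel (LAdd (LAdd (LBr s (LBr t u)) (LBr t (LBr u s)))
                       (LBr u (LBr s t))) LZero.

Section Presentation.
Context (K : fieldType) (I : Type) (rel : lie_term K I -> lie_term K I -> Prop).

Definition lie_congb (s t : lie_term K I) : bool := `[< lie_cong rel s t >].

Lemma lie_congb_equiv : equiv_class_of lie_congb.
Proof.
split.
- by move=> s; apply/asboolP; apply: LC_refl.
- by move=> s t; apply/asboolP/asboolP; apply: LC_sym.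
- by move=> t s u /asboolP st /asboolP tu; apply/asboolP; apply: LC_trans st tu.
Qed.

Canonical lie_congb_equiv_rel := EquivRelPack lie_congb_equiv.

Definition lie_pres := {eq_quot lie_congb_equiv_rel}.

HB.instance Definition _ := Choice.on lie_pres.
HB.instance Definition _ := Quotient.on lie_pres.

Local Notation pi := (\pi_lie_pres).

Lemma pi_lieP s t : pi s = pi t <-> lie_cong rel s t.
Proof.
split; first by move/eqmodP/asboolP.
by move=> st; apply/eqmodP/asboolP.
Qed.

Definition pres_zero : lie_pres := pi LZero.
Definition pres_add (x y : lie_pres) : lie_pres := pi (LAdd (repr x) (repr y)).
Definition pres_opp (x : lie_pres) : lie_pres := pi (LOpp (repr x)).
Definition pres_scale (a : K) (x : lie_pres) : lie_pres :=
  pi (LScale a (repr x)).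
Definition pres_br (x y : lie_pres) : lie_pres := pi (LBr (repr x) (repr y)).

Lemma repr_pi_lie s : lie_cong rel (repr (pi s)) s.
Proof. by apply/pi_lieP; rewrite reprK. Qed.

Lemma pres_addE s t : pres_add (pi s) (pi t) = pi (LAdd s t).
Proof. by apply/pi_lieP; apply: LC_add; apply: repr_pi_lie. Qed.
Lemma pres_oppE s : pres_opp (pi s) = pi (LOpp s).
Proof. by apply/pi_lieP; apply: LC_opp; apply: repr_pi_lie. Qed.
Lemma pres_scaleE a s : pres_scale a (pi s) = pi (LScale a s).
Proof. by apply/pi_lieP; apply: LC_scale; apply: repr_pi_lie. Qed.
Lemma pres_brE s t : pres_br (pi s) (pi t) = pi (LBr s t).
Proof. by apply/pi_lieP; apply: LC_br; apply: repr_pi_lie. Qed.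

Lemma pres_addA : associative pres_add.
Proof.
elim/quotW=> s; elim/quotW=> t; elim/quotW=> u.
rewrite (pres_addE t u) (pres_addE s t) !pres_addE.
by apply/pi_lieP; apply: LC_addA.
Qed.

Lemma pres_addC : commutative pres_add.
Proof.
elim/quotW=> s; elim/quotW=> t; rewrite (pres_addE s t) (pres_addE t s).
by apply/pi_lieP; apply: LC_addC.
Qed.

Lemma pres_add0 : left_id pres_zero pres_add.
Proof. by elim/quotW=> s; rewrite (pres_addE LZero s); apply/pi_lieP; apply: LC_add0. Qed.

Lemma pres_addN : left_inverse pres_zero pres_opp pres_add.
Proof.
elim/quotW=> s; rewrite (pres_oppE s) pres_addE.
by apply/pi_lieP; apply: LC_addN.
Qed.

HB.instance Definition _ :=
  GRing.isZmodule.Build lie_pres pres_addA pres_addC pres_add0 pres_addN.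

Lemma pres_scaleA a b x :
  pres_scale a (pres_scale b x) = pres_scale (a * b) x.
Proof.
elim/quotW: x => s; rewrite (pres_scaleE b s) !pres_scaleE.
by apply/pi_lieP; apply: LC_scaleA.
Qed.

Lemma pres_scale1 : left_id 1 pres_scale.
Proof. by elim/quotW=> s; rewrite (pres_scaleE 1 s); apply/pi_lieP; apply: LC_scale1. Qed.

Lemma pres_scaleDr : right_distributive pres_scale +%R.
Proof.
move=> a; elim/quotW=> s; elim/quotW=> t.
rewrite /GRing.add /= (pres_addE s t) (pres_scaleE a s) (pres_scaleE a t).
by rewrite pres_scaleE pres_addE; apply/pi_lieP; apply: LC_scaleDr.
Qed.

Lemma pres_scaleDl x : {morph pres_scale^~ x : a b / a + b}.
Proof.
move=> a b; elim/quotW: x => s.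
rewrite (pres_scaleE a s) (pres_scaleE b s) (pres_scaleE (a + b) s).
rewrite [RHS]/GRing.add /= pres_addE.
by apply/pi_lieP; apply: LC_scaleDl.
Qed.

HB.instance Definition _ := GRing.Zmodule_isLmodule.Build K lie_pres
  pres_scaleA pres_scale1 pres_scaleDr pres_scaleDl.

Lemma pi_lie0 : pi LZero = 0. Proof. by []. Qed.
Lemma pi_lieD s t : pi (LAdd s t) = pi s + pi t.
Proof. by rewrite -pres_addE. Qed.
Lemma pi_lieN s : pi (LOpp s) = - pi s.
Proof. by rewrite -pres_oppE. Qed.
Lemma pi_lieZ a s : pi (LScale a s) = a *: pi s.
Proof. by rewrite -pres_scaleE. Qed.

Lemma pres_brl a x y z :
  pres_br (a *: x + y) z = a *: pres_br x z + pres_br y z.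
Proof.
elim/quotW: x => s; elim/quotW: y => t; elim/quotW: z => u.
rewrite (pres_brE s u) (pres_brE t u) -!pi_lieZ -!pi_lieD pres_brE.
by apply/pi_lieP; apply: LC_brl.
Qed.

Lemma pres_brr a x y z :
  pres_br z (a *: x + y) = a *: pres_br z x + pres_br z y.
Proof.
elim/quotW: x => s; elim/quotW: y => t; elim/quotW: z => u.
rewrite (pres_brE u s) (pres_brE u t) -!pi_lieZ -!pi_lieD pres_brE.
by apply/pi_lieP; apply: LC_brr.
Qed.

Lemma pres_brxx x : pres_br x x = 0.
Proof. by elim/quotW: x => s; rewrite (pres_brE s s); apply/pi_lieP; apply: LC_brxx. Qed.

Lemma pres_jacobi x y z :
  pres_br x (pres_br y z) + pres_br y (pres_br z x) + pres_br z (pres_br x y)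
  = 0.
Proof.
elim/quotW: x => s; elim/quotW: y => t; elim/quotW: z => u.
rewrite (pres_brE t u) (pres_brE u s) (pres_brE s t) !pres_brE -!pi_lieD.
by apply/pi_lieP; apply: LC_jacobi.
Qed.

HB.instance Definition _ := Lmodule_isLieAlgebra.Build K lie_pres
  pres_brl pres_brr pres_brxx pres_jacobi.

Lemma pi_lieBr s t : pi (LBr s t) = [lie pi s, pi t].
Proof. by rewrite -pres_brE. Qed.

Definition pres_gen (i : I) : lie_pres := pi (LGen i).

End Presentation.

Fixpoint lie_eval (K : fieldType) (I : Type) (L : lieAlgType K) (g : I -> L)
    (t : lie_term K I) : L :=
  match t with
  | LGen i => g i
  | LZero => 0
  | LAdd s t => lie_eval g s + lie_eval g t
  | LOpp s => - lie_eval g s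
  | LScale a s => a *: lie_eval g s
  | LBr s t => [lie lie_eval g s, lie_eval g t]
  end.

Lemma lie_eval_gen (K : fieldType) (I : Type)
    (rel : lie_term K I -> lie_term K I -> Prop) (t : lie_term K I) :
  lie_eval (@pres_gen K I rel) t = \pi_(lie_pres rel) t.
Proof.
elim: t => //= [s -> t ->|s ->|a s ->|s -> t ->].
- by rewrite pi_lieD.
- by rewrite pi_lieN.
- by rewrite pi_lieZ.
- by rewrite pi_lieBr.
Qed.

Lemma pres_gen_rel (K : fieldType) (I : Type)
    (rel : lie_term K I -> lie_term K I -> Prop) (s t : lie_term K I) :
  rel s t -> lie_eval (@pres_gen K I rel) s = lie_eval (@pres_gen K I rel) t.
Proof. by move=> st; rewrite !lie_eval_gen; apply/pi_lieP; apply: LC_rel. Qed.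

Lemma lie_eval_cong (K : fieldType) (I : Type)
    (rel : lie_term K I -> lie_term K I -> Prop) (L : lieAlgType K)
    (g : I -> L) :
  (forall s t, rel s t -> lie_eval g s = lie_eval g t) ->
  forall s t, lie_cong rel s t -> lie_eval g s = lie_eval g t.
Proof.
move=> relg s t; elim=> //=.
- by move=> {}s {}t u _ -> _ ->.
- by move=> s1 s2 t1 t2 _ -> _ ->.
- by move=> s1 s2 _ ->.
- by move=> a s1 s2 _ ->.
- by move=> s1 s2 t1 t2 _ -> _ ->.
- by move=> *; rewrite addrA.
- by move=> *; rewrite addrC.
- by move=> *; rewrite add0r.
- by move=> *; rewrite addNr.
- by move=> *; rewrite scalerA.
- by move=> *; rewrite scale1r.
- by move=> *; rewrite scalerDr.
- by move=> *; rewrite scalerDl.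
- by move=> *; rewrite lie_linearl.
- by move=> *; rewrite lie_linearr.
- by move=> *; rewrite liexx.
- by move=> *; rewrite lie_jacobi.
Qed.

Lemma lie_pres_universal (K : fieldType) (I : Type)
    (rel : lie_term K I -> lie_term K I -> Prop) (L : lieAlgType K)
    (g : I -> L) :
  (forall s t, rel s t -> lie_eval g s = lie_eval g t) ->
  exists f : {linear lie_pres rel -> L},
    [/\ lie_morphism f, (forall i, f (pres_gen rel i) = g i)
      & forall h : {linear lie_pres rel -> L}, lie_morphism h ->
          (forall i, h (pres_gen rel i) = g i) -> h =1 f].
Proof.
move=> relg; pose f (x : lie_pres rel) : L := lie_eval g (repr x).
have fE s : f (\pi s) = lie_eval g s.
  by apply: (lie_eval_cong relg); apply: repr_pi_lie.
have f_lin : linear f.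
  move=> a; elim/quotW=> s; elim/quotW=> t.
  by rewrite -pi_lieZ -pi_lieD !fE.
pose fM := GRing.isLinear.Build K (lie_pres rel) L *:%R f f_lin.
pose fL : {linear lie_pres rel -> L} := HB.pack f fM.
exists fL; split.
- by elim/quotW=> s; elim/quotW=> t; rewrite -pi_lieBr /= !fE.
- by move=> i; rewrite /= fE.
- move=> h hM hg; elim/quotW=> t; rewrite /= fE.
  elim: t => [i||s IHs t IHt|s IHs|a s IHs|s IHs t IHt] /=.
  + exact: hg.
  + by rewrite pi_lie0 linear0.
  + by rewrite pi_lieD linearD IHs IHt.
  + by rewrite pi_lieN linearN IHs.
  + by rewrite pi_lieZ linearZ IHs.
  + by rewrite pi_lieBr hM IHs IHt.
Qed.

(* The generators are indexed from 0, which leaves |i - j| unchanged. *)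
Inductive electrical_rel (K : fieldType) (m : nat) :
    lie_term K 'I_m -> lie_term K 'I_m -> Prop :=
| ER_far (i j : 'I_m) : (2 <= `|i - j|)%N ->
    electrical_rel (LBr (LGen i) (LGen j)) LZero
| ER_near (i j : 'I_m) : `|i - j|%N = 1%N ->
    electrical_rel (LBr (LGen i) (LBr (LGen i) (LGen j)))
                   (LScale (- 2%:R) (LGen i)).

Definition electrical_A (K : fieldType) (m : nat) : lieAlgType K :=
  lie_pres (@electrical_rel K m).

Section MatrixLie.
Context (K : fieldType) (N : nat).

Definition mx_bracket (A B : 'M[K]_N) : 'M[K]_N := A *m B - B *m A.

Lemma mx_bracketl a (A B C : 'M[K]_N) :
  mx_bracket (a *: A + B) C = a *: mx_bracket A C + mx_bracket B C.
Proof.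
rewrite /mx_bracket mulmxDl mulmxDr -scalemxAl -scalemxAr scalerBr.
by rewrite opprD addrACA.
Qed.

Lemma mx_bracketr a (A B C : 'M[K]_N) :
  mx_bracket C (a *: A + B) = a *: mx_bracket C A + mx_bracket C B.
Proof.
rewrite /mx_bracket mulmxDl mulmxDr -scalemxAl -scalemxAr scalerBr.
by rewrite opprD addrACA.
Qed.

Lemma mx_bracketxx (A : 'M[K]_N) : mx_bracket A A = 0.
Proof. by rewrite /mx_bracket subrr. Qed.

Lemma mx_bracket_jacobi (A B C : 'M[K]_N) :
  mx_bracket A (mx_bracket B C) + mx_bracket B (mx_bracket C A)
    + mx_bracket C (mx_bracket A B) = 0.
Proof.
rewrite /mx_bracket !mulmxBl !mulmxBr !mulmxA !opprB.
move: (A *m B *m C) (B *m C *m A) (C *m A *m B) (A *m C *m B) (C *m B *m A)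
  (B *m A *m C) => X1 X2 X3 X4 X5 X6.
by apply/matrixP => i j; rewrite !mxE; ring.
Qed.

HB.instance Definition _ := Lmodule_isLieAlgebra.Build K 'M[K]_N
  mx_bracketl mx_bracketr mx_bracketxx mx_bracket_jacobi.

End MatrixLie.

Section OddSymplectic.
Context (K : fieldType) (n : nat).

Definition Omega : 'M[K]_(n.+1 + n.+1) := block_mx 0 1%:M (- 1%:M) 0.

(* The functional y_(n+1), as a row vector acting on column vectors: its only
   nonzero entry is at the 0-based position n. *)
Definition y_coord : 'rV[K]_(n.+1 + n.+1) :=
  delta_mx 0 (lshift n.+1 (ord_max : 'I_n.+1)).

Definition sp_mx : pred 'M[K]_(n.+1 + n.+1) :=
  fun X => X^T *m Omega + Omega *m X == 0.

Definition odd_sp_mx : pred 'M[K]_(n.+1 + n.+1) :=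
  fun X => sp_mx X && (y_coord *m X == 0).

Lemma odd_sp_mx_submod : GRing.submod_closed odd_sp_mx.
Proof.
split=> [|a X Y].
  by rewrite unfold_in /odd_sp_mx /sp_mx trmx0 mul0mx !mulmx0 addr0 !eqxx.
rewrite !unfold_in /odd_sp_mx /sp_mx => /andP[/eqP spX /eqP yX].
move=> /andP[/eqP spY /eqP yY].
rewrite linearP /= mulmxDl !mulmxDr -!scalemxAl -!scalemxAr addrACA.
by rewrite -scalerDr spX spY yX yY !scaler0 !addr0 !eqxx.
Qed.

HB.instance Definition _ :=
  GRing.isSubmodClosed.Build K 'M[K]_(n.+1 + n.+1) odd_sp_mx odd_sp_mx_submod.

Record odd_sp_type := OddSp {
  odd_sp_val :> 'M[K]_(n.+1 + n.+1);
  odd_sp_valP : odd_sp_val \in odd_sp_mx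
}.

HB.instance Definition _ := [isSub for odd_sp_val].
HB.instance Definition _ := [Choice of odd_sp_type by <:].
HB.instance Definition _ := [SubChoice_isSubLmodule of odd_sp_type by <:].

Lemma odd_sp_bracket_closed (X Y : 'M[K]_(n.+1 + n.+1)) :
  X \in odd_sp_mx -> Y \in odd_sp_mx -> [lie X, Y] \in odd_sp_mx.
Proof.
rewrite !unfold_in /odd_sp_mx /sp_mx => /andP[/eqP spX /eqP yX].
move=> /andP[/eqP spY /eqP yY]; apply/andP; split; apply/eqP.
  have tX : X^T *m Omega = - (Omega *m X) by apply/eqP; rewrite -addr_eq0 spX.
  have tY : Y^T *m Omega = - (Omega *m Y) by apply/eqP; rewrite -addr_eq0 spY.
  rewrite /lie_bracket /= /mx_bracket linearB /= !trmx_mul mulmxBl mulmxBr.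
  rewrite -!mulmxA tX tY !mulmxN !mulmxA tX tY !mulNmx !opprK.
  by rewrite addrA addrNK subrr.
by rewrite /lie_bracket /= /mx_bracket mulmxBr !mulmxA yX yY !mul0mx subrr.
Qed.

Definition odd_sp_bracket (X Y : odd_sp_type) : odd_sp_type :=
  OddSp (odd_sp_bracket_closed (odd_sp_valP X) (odd_sp_valP Y)).

Lemma odd_sp_bracketl a (X Y Z : odd_sp_type) :
  odd_sp_bracket (a *: X + Y) Z
  = a *: odd_sp_bracket X Z + odd_sp_bracket Y Z.
Proof. by apply: val_inj; rewrite /= lie_linearl. Qed.

Lemma odd_sp_bracketr a (X Y Z : odd_sp_type) :
  odd_sp_bracket Z (a *: X + Y)
  = a *: odd_sp_bracket Z X + odd_sp_bracket Z Y.
Proof. by apply: val_inj; rewrite /= lie_linearr. Qed.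

Lemma odd_sp_bracketxx (X : odd_sp_type) : odd_sp_bracket X X = 0.
Proof. by apply: val_inj; rewrite /= liexx. Qed.

Lemma odd_sp_bracket_jacobi (X Y Z : odd_sp_type) :
  odd_sp_bracket X (odd_sp_bracket Y Z)
    + odd_sp_bracket Y (odd_sp_bracket Z X)
    + odd_sp_bracket Z (odd_sp_bracket X Y) = 0.
Proof. by apply: val_inj; rewrite /= lie_jacobi. Qed.

HB.instance Definition _ := Lmodule_isLieAlgebra.Build K odd_sp_type
  odd_sp_bracketl odd_sp_bracketr odd_sp_bracketxx odd_sp_bracket_jacobi.

Definition odd_sp : lieAlgType K := odd_sp_type.

End OddSymplectic.

(* Main.v *)
(** The form on [K^(2n+1)] whose Gram matrix is [+-1] between neighbours and [0]
    elsewhere has rank [2n], so it is the restriction of the symplectic form to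
    the hyperplane [y_(n+1) = 0] in a suitable basis [v_k]. The Lie algebra
    [odd_sp] is the symmetric square of this hyperplane, and [e_k |-> +- v_k^2]
    respects the electrical relations. In [electrical_A] the nested brackets
    [[e_i, [e_(i+1), ... e_j]]], suitably scaled, are acted on by the generators
    exactly as the symmetric products [v_i v_j]. Sending [v_i v_j] back to these
    brackets therefore gives a map commuting with the adjoint action, and an
    induction on Lie terms shows that it inverts [e_k |-> +- v_k^2]. *)
From HB Require Import structures.
Require Import Defs.
From mathcomp Require Import all_boot all_algebra reals complex.
From mathcomp Require Import zify ring.

Set Implicit Arguments.
Unset Strict Implicit.
Unset Printing Implicit Defensive.

Import GRing.Theory.
Local Open Scope ring_scope.

(** * Identities in an arbitrary Lie algebra *)

Section LieTheory.
Context (K : fieldType) (L : lieAlgType K).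
Implicit Types (x y z e a b : L) (c : K).

Lemma lieDl x y z : [lie x + y, z] = [lie x, z] + [lie y, z].
Proof. by rewrite -[x]scale1r lie_linearl !scale1r. Qed.

Lemma lieDr x y z : [lie z, x + y] = [lie z, x] + [lie z, y].
Proof. by rewrite -[x]scale1r lie_linearr !scale1r. Qed.

Lemma lie0l x : [lie 0, x] = 0.
Proof. by apply: (addIr [lie 0, x]); rewrite -lieDl !add0r. Qed.

Lemma lie0r x : [lie x, 0] = 0.
Proof. by apply: (addIr [lie x, 0]); rewrite -lieDr !add0r. Qed.

Lemma lieZl c x y : [lie c *: x, y] = c *: [lie x, y].
Proof. by rewrite -[c *: x]addr0 lie_linearl lie0l addr0. Qed.

Lemma lieZr c x y : [lie y, c *: x] = c *: [lie y, x].
Proof. by rewrite -[c *: x]addr0 lie_linearr lie0r addr0. Qed.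

Lemma lieNl x y : [lie - x, y] = - [lie x, y].
Proof. by rewrite -scaleN1r lieZl scaleN1r. Qed.

Lemma lieNr x y : [lie y, - x] = - [lie y, x].
Proof. by rewrite -scaleN1r lieZr scaleN1r. Qed.

Lemma lieC x y : [lie x, y] = - [lie y, x].
Proof.
apply/eqP; rewrite -addr_eq0.
have := liexx (x + y); rewrite lieDl !lieDr !liexx add0r addr0.
by move=> ->.
Qed.

Lemma lie_derivation x y z :
  [lie x, [lie y, z]] = [lie [lie x, y], z] + [lie y, [lie x, z]].
Proof.
apply/eqP; rewrite -subr_eq0 (lieC [lie x, y]) (lieC x z) lieNr opprD !opprK.
by rewrite addrA addrAC lie_jacobi.
Qed.

Lemma lie_sumr (I : Type) (r : seq I) (F : I -> L) x :
  [lie x, \sum_(i <- r) F i] = \sum_(i <- r) [lie x, F i].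
Proof. exact: (big_morph _ (fun y z => lieDr y z x) (lie0r x)). Qed.

Lemma lie_commute x y z : [lie x, y] = 0 -> [lie x, [lie y, z]] = [lie y, [lie x, z]].
Proof. by move=> xy; rewrite lie_derivation xy lie0l add0r. Qed.

(* Expand [(ad e)^2] applied to [lie a, b] = 0 by the Leibniz rule. *)
Lemma lie_electrical_core e a b :
  [lie a, b] = 0 -> [lie e, [lie e, a]] = (- 2%:R) *: e ->
  2%:R *: [lie e, [lie a, [lie e, b]]]
  = 2%:R *: [lie e, b] + [lie a, [lie e, [lie e, b]]].
Proof.
move=> ab eea.
have /eqP : [lie e, [lie e, [lie a, b]]] = 0 by rewrite ab !lie0r.
rewrite (lie_derivation e a b) lieDr (lie_derivation e [lie e, a] b) eea lieZl.
rewrite -addrA scaleNr addrC subr_eq0 => /eqP <-.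
by rewrite scaler_nat mulr2n (lie_derivation e a [lie e, b]) -!addrA (addrCA [lie a, _]).
Qed.

End LieTheory.

(** * Nested brackets of elements satisfying the electrical relations *)

Definition adjacent (i j : nat) : bool := (i == j.+1) || (j == i.+1).

Section Chains.
Context (K : fieldType) (L : lieAlgType K) (m : nat) (e : nat -> L).
Fixpoint chain (d i : nat) : L :=
  if d is d'.+1 then [lie e i, chain d' i.+1] else e i.

Lemma chainS d i : chain d.+1 i = [lie e i, chain d i.+1].
Proof. by []. Qed.

Definition alt (i : nat) : K := if odd i then 1 else -1.

Lemma altS i : alt i.+1 = - alt i.
Proof. by rewrite /alt /=; case: odd; rewrite ?opprK. Qed.

Lemma alt_sqr i : alt i * alt i = 1.
Proof. by rewrite /alt; case: odd; rewrite ?mulrNN mulr1. Qed.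

(* The counterpart of the symmetric product [v_i v_j]; [chain d i] is the nested
   bracket of [e_i, ..., e_(i+d)]. The factor [2 * alt i] on the diagonal and the
   sign [alt] off it make all signs disappear from [root_vec_bracket]. *)
Definition root_vec (i j : nat) : L :=
  if i == j then (2%:R * alt i) *: e i
  else alt (maxn i j) *: chain (maxn i j - minn i j) (minn i j).

Lemma root_vecC i j : root_vec i j = root_vec j i.
Proof. by rewrite /root_vec eq_sym maxnC minnC; case: eqVneq => // ->. Qed.

Lemma root_vecii i : root_vec i i = (2%:R * alt i) *: e i.
Proof. by rewrite /root_vec eqxx. Qed.

Lemma root_vecE i d : root_vec i (i + d.+1) = alt (i + d.+1) *: chain d.+1 i.
Proof.
rewrite /root_vec ifF; last by lia.
by rewrite (maxn_idPr _) ?(minn_idPl _) ?leq_addr // addKn.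
Qed.

Hypothesis two_neq0 : 2%:R != 0 :> K.
Hypothesis e_far : forall i j, (i.+2 <= j)%N -> [lie e i, e j] = 0.
Hypothesis e_near : forall i j, (i < m)%N -> (j < m)%N -> adjacent i j ->
  [lie e i, [lie e i, e j]] = (- 2%:R) *: e i.

Lemma e_far_sym i j : (j.+2 <= i)%N -> [lie e i, e j] = 0.
Proof. by move=> ji; rewrite lieC e_far ?oppr0. Qed.

Lemma chain_far_left d i k : (k.+2 <= i)%N -> [lie e k, chain d i] = 0.
Proof.
elim: d i => [|d IH] i ki /=; first exact: e_far.
by rewrite lie_commute ?e_far // IH ?lie0r //; lia.
Qed.

Lemma chain_far_right d i k : (i + d + 2 <= k)%N -> [lie e k, chain d i] = 0.
Proof.
elim: d i => [|d IH] i ki /=; first by apply: e_far_sym; lia.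
by rewrite lie_commute ?IH ?lie0r // ?e_far_sym //; lia.
Qed.

(** The new generator commutes with all but the last entry of the chain, so it moves inwards;
    antisymmetry at the innermost bracket gives the sign. *)
Lemma chain_extend d i : [lie e (i + d).+1, chain d i] = - chain d.+1 i.
Proof.
elim: d i => [|d IH] i /=; first by rewrite addn0 lieC.
rewrite lie_commute; first by rewrite addnS -addSn IH lieNr.
by rewrite e_far_sym //; lia.
Qed.

Lemma chain_first1 i : (i.+1 < m)%N -> [lie e i, chain 1 i] = (- 2%:R) *: e i.
Proof. by move=> im; rewrite /= e_near // /adjacent; lia. Qed.

(** Since [e i] commutes with the tail [chain d i.+2], both copies of [e i] act on [e i.+1] alone;
    the result [-2 e i] is then bracketed with that tail. *)
Lemma chain_first d i : (i.+1 < m)%N -> [lie e i, chain d.+2 i] = 0.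
Proof.
move=> im; rewrite /= (lie_derivation (e i) (e i.+1)) [X in _ + X](_ : _ = 0).
  rewrite addr0 lie_derivation e_near //; last by rewrite /adjacent; lia.
    by rewrite lieZl chain_far_left // scaler0 lie0r addr0.
  lia.
by rewrite chain_far_left // lie0r.
Qed.

Lemma chain_last1 i : (i.+1 < m)%N -> [lie e i.+1, chain 1 i] = 2%:R *: e i.+1.
Proof.
move=> im; rewrite /= (lieC (e i)) lieNr e_near ?scaleNr ?opprK // /adjacent; lia.
Qed.

Lemma chain_last d i : (i + d.+2 < m)%N -> [lie e (i + d.+2), chain d.+2 i] = 0.
Proof.
elim: d i => [|d IH] i im; rewrite chainS lie_commute ?e_far_sym //; try lia.
  by rewrite addn2 chain_last1 ?lieZr ?e_far ?scaler0 //; lia.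
by rewrite addnS -addSn IH ?lie0r //; lia.
Qed.

(** This is [lie_electrical_core] with [a = e i] and [e i.+1] acting on [b = chain d i.+2]. Its last
    term vanishes by [chain_first], except that for [d = 0] the near relation leaves [-2
    [e_i, e_(i+1)]]. The core identity is doubled, hence the division by 2. *)
Lemma chain_second d i : (i.+2 < m)%N ->
  [lie e i.+1, chain d.+2 i]
  = chain d.+1 i.+1 - (if d is 0 then chain 1 i else 0).
Proof.
move=> im; apply: (scalerI two_neq0); rewrite [chain _.+2 _]/=.
rewrite lie_electrical_core; last 2 first.
- exact: chain_far_left.
- by apply: e_near; rewrite /adjacent; lia.
case: d => [|d].
  by rewrite /= scalerBr e_near ?lieZr ?scaleNr // /adjacent; lia.
rewrite -[[lie e i.+1, chain d.+1 i.+2]]/(chain d.+2 i.+1).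
by rewrite chain_first ?lie0r ?subr0 ?addr0.
Qed.

Lemma chain_inside d i k : (i + d < m)%N -> (i.+1 < k)%N -> (k < i + d)%N ->
  [lie e k, chain d i] = - (if k == (i + d).-1 then chain d.-1 i else 0).
Proof.
elim: d i => [|d IH] i dm ik kd; first by lia.
rewrite chainS lie_commute ?e_far_sym //.
(* Leading generators commuting with [e k] are peeled off until [k] is second in the inner chain.
   The main term of [chain_second] then starts at [i.+2] and is killed by [e i]; only its correction
   term can survive. *)
have [ik2|ik2] := eqVneq k i.+2.
  case: d dm kd {IH} => [|[|d]] dm kd; try lia.
  rewrite ik2 chain_second; last by lia.
  case: d dm kd => [|d] dm kd.
  have -> : (i.+2 == (i + 3).-1) by lia.
    by rewrite lieDr lieNr (@chain_far_left 1 i.+2) ?add0r.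
  have -> : (i.+2 == (i + d.+4).-1) = false by lia.
  by rewrite subr0 chain_far_left ?oppr0.
rewrite IH; try lia.
rewrite addSnnS lieNr; case: ifP => _; last by rewrite lie0r.
by case: d dm kd {IH} => [|d] //=; lia.
Qed.

(** This is the Leibniz rule on [v_i v_j] for the action sending [v_i] to [v_k] when [k] and [i] are
    adjacent, and to 0 otherwise. By symmetry [i <= j]; the cases follow the position of [k]
    relative to the interval from [i] to [j]. *)
Lemma root_vec_bracket i j k : (i < m)%N -> (j < m)%N -> (k < m)%N ->
  [lie e k, root_vec i j]
  = (adjacent k i)%:R *: root_vec k j + (adjacent k j)%:R *: root_vec i k.
Proof.
wlog ij : i j / (i <= j)%N.
  move=> W im jm km; case: (leqP i j) => [|/ltnW] ij; first exact: W.
  by rewrite root_vecC W // addrC (root_vecC k i) (root_vecC j k).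
move=> im jm km.
have [d def_j] : exists d, j = (i + d)%N by exists (j - i)%N; lia.
have t0 x y : ~~ adjacent x y -> (adjacent x y)%:R = 0 :> K by move/negPf=> ->.
have t1 x y : adjacent x y -> (adjacent x y)%:R = 1 :> K by move=> ->.
have rv x y z : (x < y)%N -> z = (y - x)%N ->
    root_vec x y = alt y *: chain z x.
  move=> xy ->; rewrite -[X in root_vec x X](subnKC xy) addSnnS root_vecE.
  by rewrite -addSnnS subnKC // subnSK.
rewrite /adjacent in t0 t1; rewrite {ij}def_j in jm *; case: d jm => [|d] jm.
  rewrite addn0 root_vecii lieZr -[e i]/(chain 0 i).
  have [->|ki] := eqVneq k i; first by rewrite liexx !t0 ?scale0r ?addr0 ?scaler0 //; lia.
  have [ik|ik] := eqVneq i k.+1.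
    rewrite ik !t1 ?eqxx ?orbT // !scale1r (root_vecC _ k) (rv k k.+1 1%N) //; last lia.
    by rewrite -scalerDl; congr (_ *: _); ring.
  have [ik'|ik'] := eqVneq k i.+1.
    rewrite ik' -[i in e i.+1]addn0 chain_extend !t1 ?eqxx // !scale1r (root_vecC _ i).
    rewrite (rv i i.+1 1%N) //; last lia.
    by rewrite -scalerDl scalerN -scaleNr altS; congr (_ *: _); ring.
  rewrite !t0 ?scale0r; try lia; rewrite addr0.
  have [k1|k1] : (k.+2 <= i)%N \/ (i + 0 + 2 <= k)%N by lia.
    by rewrite chain_far_left ?scaler0.
  by rewrite chain_far_right ?scaler0.
rewrite root_vecE lieZr.
have [k1|k1] := leqP k.+2 i.
  by rewrite chain_far_left // !t0 ?scale0r ?scaler0 ?addr0 //; lia.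
have [ik|ik] := eqVneq i k.+1.
  rewrite ik -chainS t1 ?t0; try lia.
  by rewrite scale1r scale0r addr0 (rv _ _ d.+2) //; lia.
have [k2|k2] := leqP (i + d.+1 + 2)%N k.
  by rewrite chain_far_right // !t0 ?scale0r ?scaler0 ?addr0 //; lia.
have [jk|jk] := eqVneq k (i + d.+1).+1.
  rewrite jk chain_extend t0 ?t1; try lia.
  rewrite scale1r scale0r add0r (rv _ _ d.+2) //; try lia.
  by rewrite altS scaleNr scalerN.
have [ki|ki] := eqVneq k i.
  rewrite ki t0; last lia.
  rewrite scale0r add0r; case: d jm {k1 k2 jk ik} => [|d] jm.
    rewrite chain_first1; last lia.
    rewrite t1 ?scale1r ?root_vecii ?addn1 ?altS ?scalerA; try lia.
    by congr (_ *: _); ring.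
  by rewrite chain_first ?scaler0 ?t0 ?scale0r //; lia.
have [kj|kj] := eqVneq k (i + d.+1)%N.
  rewrite kj [X in _ + X *: _]t0; last lia.
  rewrite scale0r addr0; case: d jm {k1 k2 jk ik ki kj} => [|d] jm.
    rewrite addn1 chain_last1; last lia.
    by rewrite t1 ?scale1r ?root_vecii ?scalerA 1?mulrC //; lia.
  by rewrite chain_last ?scaler0 ?t0 ?scale0r //; lia.
have [ki1|ki1] := eqVneq k i.+1.
  rewrite ki1; case: d jm {k1 k2 jk ik ki} kj => [|d] jm kj; first lia.
  rewrite chain_second; last lia.
  rewrite t1; last lia.
  rewrite scale1r (rv _ _ d.+1) //; try lia.
  rewrite scalerBr; congr (_ + _); case: d jm kj => [|d] jm kj.
    rewrite t1; last lia.
    rewrite scale1r (rv _ _ 1%N) //; try lia.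
    by rewrite addn2 altS scaleNr opprK.
  by rewrite t0 ?scale0r ?scaler0 ?oppr0 //; lia.
rewrite chain_inside; try lia.
rewrite t0; last lia.
rewrite scale0r add0r; case: eqVneq => [k3|k3].
  rewrite t1 ?scale1r ?(rv _ _ d) //; try lia.
  rewrite scalerN -scaleNr (_ : (i + d.+1)%N = k.+1) ?altS ?opprK //; lia.
by rewrite t0 ?scale0r ?oppr0 ?scaler0 //; lia.
Qed.

End Chains.

(** * The chain basis and the coordinates of odd symplectic matrices *)

Section ChainForm.
Context (K : fieldType) (n : nat).
Local Notation m := (2 * n + 1)%N.
Local Notation N := (n.+1 + n.+1)%N.
Local Notation Om := (Omega K n).
Local Notation y := (y_coord K n).

(* The rows are [v_(2a) = q_a + q_(a-1)] and [v_(2a+1) = p_a], where the [p_a] are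
   the first [n+1] coordinate vectors and the [q_a] the last [n+1]. *)
Definition chain_basis : 'M[K]_(m, N) :=
  row_mx (\matrix_(k, a) (k == a.*2.+1 :> nat)%:R)
         (\matrix_(k, a) ((k == a.*2 :> nat) || (k == a.*2.+2 :> nat))%:R).
Local Notation U := chain_basis.

(** The form pairs [p]'s only with [q]'s, so a nonzero entry joins an odd index to an even
    neighbour, and the sign tells which comes first. *)
Lemma chain_gram (k l : 'I_m) :
  (U *m Om *m U^T) k l = alt K k * (adjacent k l)%:R.
Proof.
rewrite /U /Omega mul_row_block !mulmx0 !mulmx1 mulmxN mulmx1 add0r addr0.
rewrite tr_row_mx mul_row_col mulNmx !mxE.
have inn (u v : 'I_m) : \sum_(a < n.+1) (u == a.*2.+1 :> nat)%:R
      * ((v == a.*2 :> nat) || (v == a.*2.+2 :> nat))%:R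
    = (odd u && adjacent u v)%:R :> K.
  (* Only the summand [a = u./2] can be nonzero. *)
  have ltu : (u./2 < n.+1)%N by have := ltn_ord u; lia.
  rewrite (bigD1 (Ordinal ltu)) //= big1 ?addr0 => [|a aN].
    by rewrite -natrM mulnb; congr (nat_of_bool _)%:R; rewrite /adjacent; lia.
  rewrite [_ == _](_ : _ = false) ?mul0r //; apply/negP => /eqP ua.
  by case/eqP: aN; apply: val_inj => /=; lia.
under eq_bigr do rewrite !mxE mulrC.
under [X in _ + X]eq_bigr do rewrite !mxE.
rewrite !inn /alt /adjacent; case: (eqVneq (k : nat) l.+1) => [->|kl] /=.
  by case: odd; rewrite ?orbT /= ?orbT; ring.
case: (eqVneq (l : nat) k.+1) => [->|lk] /=; first by case: odd; rewrite ?orbT /=; ring.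
by rewrite ?orbF ?andbF /=; ring.
Qed.

Lemma y_chain_basis : U *m y^T = 0.
Proof.
apply/matrixP => k z; rewrite /y_coord trmx_delta -colE mxE row_mxEl !mxE.
(* The vector [p_n] would be row [2n+1], which is out of range. *)
by rewrite [_ == _](_ : _ = false) //=; have := ltn_ord k; lia.
Qed.

Lemma chain_basis_p (a : 'I_n.+1) : (a < n)%N ->
  ((delta_mx 0 (lshift n.+1 a) : 'rV[K]_N) <= U)%MS.
Proof.
move=> an; have lt : (a.*2.+1 < m)%N by lia.
suff -> : delta_mx 0 (lshift n.+1 a) = row (Ordinal lt) U by apply: row_sub.
apply/rowP => z; rewrite mxE [RHS]mxE -[z]splitK.
case: (split z) => b /=; rewrite ?row_mxEl ?row_mxEr !mxE (eq_lshift, eq_rlshift) //=.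
  by rewrite -val_eqE; congr (nat_of_bool _)%:R => /=; lia.
by rewrite [(_ || _)](_ : _ = false) //; lia.
Qed.

(** Recursively, [q_0 = v_0] and [q_(a+1) = v_(2a+2) - q_a]. *)
Lemma chain_basis_q (a : 'I_n.+1) : ((delta_mx 0 (rshift n.+1 a) : 'rV[K]_N) <= U)%MS.
Proof.
case: a => a; elim: a => [|a IH] an.
  have lt : (0 < m)%N by lia.
  suff -> : delta_mx 0 (rshift n.+1 (Ordinal an)) = row (Ordinal lt) U by apply: row_sub.
  apply/rowP => z; rewrite mxE [RHS]mxE -[z]splitK.
  case: (split z) => b /=; rewrite ?row_mxEl ?row_mxEr !mxE (eq_rshift, eq_lrshift) //=.
  by rewrite -val_eqE; congr (nat_of_bool _)%:R => /=; lia.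
have lt : (a.*2.+2 < m)%N by lia.
suff -> : delta_mx 0 (rshift n.+1 (Ordinal an))
    = row (Ordinal lt) U - delta_mx 0 (rshift n.+1 (Ordinal (ltnW an))).
  by rewrite addmx_sub ?eqmx_opp ?row_sub ?IH.
apply/rowP => z; rewrite mxE [RHS]mxE [X in X + _]mxE [X in _ + X]mxE -[z]splitK.
case: (split z) => b /=; rewrite ?row_mxEl ?row_mxEr !mxE (eq_rshift, eq_lrshift) /=.
  by rewrite eq_lrshift subr0 [_ == _](_ : _ = false) //; lia.
rewrite (eq_rshift) -!val_eqE /=; apply/eqP; rewrite eq_sym subr_eq -natrD.
by apply/eqP; congr _%:R; lia.
Qed.

Lemma chain_basis_span r (X : 'M[K]_(r, N)) : X *m y^T = 0 -> (X <= U)%MS.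
Proof.
move=> Xy; apply/row_subP => i; rewrite (row_sum_delta (row i X)).
apply: summx_sub => z _; rewrite -[z]splitK; case: (split z) => b /=; last first.
  by rewrite scalemx_sub ?chain_basis_q.
have [bn|bn] := ltnP b n; first by rewrite scalemx_sub ?chain_basis_p.
have -> : b = ord_max by apply: val_inj => /=; have := ltn_ord b; lia.
move/matrixP/(_ i 0): Xy; rewrite /y_coord trmx_delta -colE !mxE => ->.
by rewrite scale0r sub0mx.
Qed.

(** The row space contains the kernel of [y], whose dimension is at least [2n+1], the number of
    rows. *)
Lemma chain_basis_free : row_free U.
Proof.
rewrite /row_free eqn_leq rank_leq_row /=.
have : (kermx y^T <= U)%MS by rewrite chain_basis_span ?mulmx_ker.
move/mxrankS; apply: leq_trans; rewrite mxrank_ker mxrank_tr.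
by have := rank_leq_row y; lia.
Qed.

(* A symmetric [A] stands for the quadratic form [\sum_(i, j) A i j * v_i * v_j]. *)
Definition sp_of (A : 'M[K]_m) : 'M[K]_N := U^T *m A *m U *m Om.

(** As [Om] squares to [-1], the equation [X = sp_of A] reads [U^T A U = - X Om]; it is solved with
    the right inverse [pinvmx U] of [U]. *)
Definition sp_coord (X : 'M[K]_N) : 'M[K]_m :=
  (pinvmx U)^T *m (- (X *m Om)) *m pinvmx U.

Lemma Omega_sqr : Om *m Om = - 1%:M.
Proof.
rewrite /Omega mulmx_block !mul0mx !mulmx0 !mulNmx !mulmxN !mulmx1 !addr0 !add0r.
by rewrite (scalar_mx_block n.+1 n.+1 (1 : K)) opp_block_mx oppr0.
Qed.

Lemma tr_Omega : Om^T = - Om.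
Proof.
by rewrite /Omega tr_block_mx !trmx0 linearN /= !trmx1 opp_block_mx !oppr0 opprK.
Qed.

Lemma sp_ofK A : sp_coord (sp_of A) = A.
Proof.
rewrite /sp_coord; have := mulmxVp chain_basis_free; move: (pinvmx U) => P UP.
rewrite /sp_of -(mulmxA _ Om Om) Omega_sqr !mulmxN mulmx1 opprK !mulmxA -trmx_mul UP.
by rewrite trmx1 mul1mx -mulmxA UP mulmx1.
Qed.

Lemma sp_of_linear : linear sp_of.
Proof. by move=> a A B; rewrite /sp_of mulmxDr !mulmxDl -scalemxAr -!scalemxAl. Qed.

HB.instance Definition _ := GRing.isLinear.Build K _ _ _ sp_of sp_of_linear.

Lemma sp_coord_linear : linear sp_coord.
Proof.
move=> a A B; rewrite /sp_coord mulmxDl opprD mulmxDr mulmxDl.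
by rewrite -!scalemxAl -scalerN -scalemxAr -scalemxAl.
Qed.

HB.instance Definition _ := GRing.isLinear.Build K _ _ _ sp_coord sp_coord_linear.

Lemma sp_of_bracket A B (G := U *m Om *m U^T) :
  [lie sp_of A, sp_of B] = sp_of (A *m G *m B - B *m G *m A).
Proof.
by rewrite linearB /= /lie_bracket /= /mx_bracket /sp_of /G !mulmxA.
Qed.

Lemma sp_of_odd A : A^T = A -> sp_of A \in @odd_sp_mx K n.
Proof.
move=> tA; rewrite unfold_in /odd_sp_mx /sp_mx /sp_of.
rewrite !trmx_mul trmxK tA tr_Omega !mulNmx !mulmxA addNr eqxx /=.
by rewrite -{1}[y]trmxK -trmx_mul y_chain_basis trmx0 !mul0mx eqxx.
Qed.

Section Coordinates.
Variable X : 'M[K]_N.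
Hypothesis oddX : X \in @odd_sp_mx K n.

Lemma odd_sp_form_sym : (X *m Om)^T = X *m Om.
Proof.
have := oddX; rewrite unfold_in /odd_sp_mx /sp_mx => /andP[+ _].
rewrite addr_eq0 => /eqP spX.
have : Om *m (X^T *m Om) *m Om = Om *m (- (Om *m X)) *m Om by rewrite spX.
rewrite mulmxN !mulmxA Omega_sqr !mulNmx mul1mx opprK -mulmxA Omega_sqr.
by rewrite mulmxN mulmx1 trmx_mul tr_Omega mulNmx.
Qed.

Lemma sp_coord_sym : (sp_coord X)^T = sp_coord X.
Proof.
rewrite /sp_coord; move: (pinvmx U) => P.
by rewrite trmx_mul (trmx_mul P^T) trmxK linearN /= odd_sp_form_sym mulmxA.
Qed.

Lemma sp_coordK : sp_of (sp_coord X) = X.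
Proof.
(* The matrix [X Om] is symmetric and [y X = 0], so its rows lie in the hyperplane spanned by [U].
   Transposing gives the same for its columns. *)
have XU : X *m Om *m pinvmx U *m U = X *m Om.
  rewrite mulmxKpV //; apply: chain_basis_span; rewrite -{1}odd_sp_form_sym -trmx_mul.
  have := oddX; rewrite unfold_in /odd_sp_mx => /andP[_ /eqP yX].
  by rewrite mulmxA yX mul0mx trmx0.
have UX : U^T *m (pinvmx U)^T *m (X *m Om) = X *m Om.
  by rewrite -trmx_mul -{1}odd_sp_form_sym -trmx_mul mulmxA XU odd_sp_form_sym.
rewrite /sp_of /sp_coord; move: (pinvmx U) XU UX => P XU UX.
rewrite mulmxN !mulNmx mulmxN !mulNmx.
rewrite (mulmxA U^T) (mulmxA U^T) UX XU -mulmxA Omega_sqr.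
by rewrite mulmxN mulmx1 opprK.
Qed.

End Coordinates.

End ChainForm.

Lemma adjacentC i j : adjacent i j = adjacent j i.
Proof. by rewrite /adjacent orbC. Qed.

Lemma alt_adjacent (K : fieldType) i j : adjacent i j -> alt K i = - alt K j.
Proof. by case/orP=> /eqP ->; rewrite altS ?opprK. Qed.

(** Extension by zero lets chains be indexed by all naturals. The far relations persist beyond [m];
    the near ones are only claimed below it. *)
Definition ext0 (m : nat) (V : zmodType) (e : 'I_m -> V) (k : nat) : V :=
  oapp e 0 (insub k).

Lemma ext0_ord m (V : zmodType) (e : 'I_m -> V) (i : 'I_m) : ext0 e i = e i.
Proof. by rewrite /ext0 valK. Qed.

Lemma ext0_out m (V : zmodType) (e : 'I_m -> V) k : (m <= k)%N -> ext0 e k = 0.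
Proof. by move=> mk; rewrite /ext0 insubF //= ltnNge mk. Qed.

Lemma chain_morph (K : fieldType) (L M : lieAlgType K) (f : {linear L -> M})
    (e : nat -> L) (e' : nat -> M) d i :
  lie_morphism f -> (forall k, f (e k) = e' k) -> f (chain e d i) = chain e' d i.
Proof. by move=> fM fe; elim: d i => [|d IH] i //=; rewrite fM fe IH. Qed.

(** * The electrical relations inside the odd symplectic algebra *)

Section OddSpModel.
Context (K : fieldType) (n : nat).
Local Notation m := (2 * n + 1)%N.
Local Notation U := (chain_basis K n).
Local Notation G := (U *m Omega K n *m U^T).

Lemma delta_mul_delta (M : 'M[K]_m) i j k l :
  delta_mx i j *m M *m delta_mx k l = M j k *: delta_mx i l :> 'M[K]_m.
Proof.
have Mjk : delta_mx 0 j *m M *m delta_mx k 0 = (M j k)%:M :> 'M_1.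
  by apply/matrixP => a b; rewrite -rowE -colE !mxE !ord1.
rewrite -(mul_delta_mx (0 : 'I_1) i j) -(mul_delta_mx (0 : 'I_1) k l) !mulmxA.
rewrite -!(mulmxA (delta_mx i 0)) Mjk mul_scalar_mx -scalemxAr.
by rewrite mul_delta_mx.
Qed.

(** The products pick out the Gram entries at [(k, i)] and [(j, k)]. Neighbouring indices have
    opposite [alt], which turns the minus sign of the second term into a plus. *)
Lemma ad_delta (k i j : 'I_m) :
  (alt K k *: delta_mx k k) *m G *m delta_mx i j
    - delta_mx i j *m G *m (alt K k *: delta_mx k k)
  = (adjacent k i)%:R *: delta_mx k j + (adjacent k j)%:R *: delta_mx i k.
Proof.
rewrite -scalemxAr -!scalemxAl !delta_mul_delta !chain_gram !scalerA mulrA alt_sqr mul1r.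
rewrite -scaleNr; congr (_ + _ *: _).
rewrite (adjacentC j); case kj: adjacent; last by rewrite !mulr0 oppr0.
by rewrite (alt_adjacent K kj) !mulr1 mulNr opprK alt_sqr.
Qed.

Lemma scaled_delta_sym (k : 'I_m) : (alt K k *: delta_mx k k)^T = alt K k *: delta_mx k k.
Proof. by rewrite linearZ /= trmx_delta. Qed.

Lemma sym_delta_sym (i j : 'I_m) :
  (delta_mx i j + delta_mx j i)^T = delta_mx i j + delta_mx j i :> 'M[K]_m.
Proof. by rewrite linearD /= !trmx_delta addrC. Qed.

Definition sp_gen (k : 'I_m) : odd_sp K n := OddSp (sp_of_odd (scaled_delta_sym k)).

(** This is twice the quadratic form [v_i v_j], whence the 2 on the diagonal of [root_vec] and the
    halves below. *)
Definition sp_root (i j : 'I_m) : odd_sp K n := OddSp (sp_of_odd (sym_delta_sym i j)).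

Lemma sp_rootC i j : sp_root i j = sp_root j i.
Proof. by apply: val_inj; rewrite /= addrC. Qed.

Lemma sp_root_diag i : sp_root i i = (2%:R * alt K i) *: sp_gen i.
Proof.
apply: val_inj; rewrite /= -linearZ /= scalerA -mulrA alt_sqr mulr1.
by rewrite scaler_nat mulr2n.
Qed.

Lemma sp_gen_bracket k i j :
  [lie sp_gen k, sp_root i j]
  = (adjacent k i)%:R *: sp_root k j + (adjacent k j)%:R *: sp_root i k.
Proof.
pose D a b : 'M[K]_m := delta_mx a b + delta_mx b a.
apply: val_inj; change ([lie sp_of (alt K k *: delta_mx k k), sp_of (D i j)]
  = (adjacent k i)%:R *: sp_of (D k j) + (adjacent k j)%:R *: sp_of (D i k)).
rewrite sp_of_bracket -!linearZ -linearD /=; congr sp_of.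
rewrite /D mulmxDr !mulmxDl opprD addrACA !ad_delta !scalerDr.
by rewrite -!addrA; congr (_ + _); rewrite addrA addrC.
Qed.

Hypothesis two_neq0 : 2%:R != 0 :> K.

Lemma sp_gen_root i : sp_gen i = (2%:R^-1 * alt K i) *: sp_root i i.
Proof.
rewrite sp_root_diag scalerA mulrACA mulVf // mul1r alt_sqr scale1r //.
Qed.

(** For neighbours, two brackets with [sp_gen i] turn [v_j v_j] into a multiple of [v_i v_i]; the
    constant is [2 alt_i alt_j = -2]. *)
Lemma sp_gen_rel s t : electrical_rel s t -> lie_eval sp_gen s = lie_eval sp_gen t.
Proof.
case=> i j ij /=; rewrite (sp_gen_root j) !lieZr sp_gen_bracket.
  rewrite [adjacent i j](_ : _ = false) ?scale0r ?addr0 ?scaler0 //.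
  by rewrite /adjacent; lia.
have aij : adjacent i j by rewrite /adjacent; lia.
rewrite aij !scale1r (sp_rootC j) lieDr sp_gen_bracket aij.
rewrite [adjacent i i](_ : _ = false); last by rewrite /adjacent; lia.
rewrite scale0r add0r scale1r.
rewrite -mulr2n -scaler_nat sp_root_diag !scalerA; congr (_ *: _).
rewrite (alt_adjacent K aij).
transitivity (2%:R^-1 * 2%:R * (alt K j * alt K j) * - 2%:R : K); first by ring.
by rewrite mulVf // alt_sqr; ring.
Qed.

Lemma chain_sp_root d (i j : 'I_m) : j = (i + d.+1)%N :> nat ->
  alt K j *: chain (ext0 sp_gen) d.+1 i = sp_root i j.
Proof.
elim: d i => [|d IH] i ji; rewrite chainS ext0_ord.
  rewrite (_ : i.+1 = j) /=; last lia.
  rewrite ext0_ord (sp_gen_root j) lieZr sp_gen_bracket.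
  have -> : adjacent i j by rewrite /adjacent; lia.
  rewrite !scale1r (sp_rootC j) -mulr2n -scaler_nat !scalerA.
  by rewrite mulrCA alt_sqr mulr1 mulVf // scale1r.
have lti : (i.+1 < m)%N by have := ltn_ord j; lia.
rewrite -lieZr -[i.+1]/(Ordinal lti : nat) IH; last by rewrite /=; lia.
rewrite sp_gen_bracket [adjacent _ j](_ : _ = false); last by rewrite /adjacent; lia.
have -> : adjacent i (Ordinal lti) by rewrite /adjacent /=; lia.
by rewrite scale0r addr0 scale1r.
Qed.

Lemma root_vec_sp (i j : 'I_m) : root_vec (ext0 sp_gen) i j = sp_root i j.
Proof.
wlog ij : i j / (i <= j)%N.
  by case: (leqP i j) => [|/ltnW] ij W; [|rewrite root_vecC sp_rootC]; apply: W.
have [ij0|ijN] := eqVneq (i : nat) j.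
  by rewrite (val_inj ij0) root_vecii ext0_ord sp_root_diag.
have ji : j = (i + (j - i).-1.+1)%N :> nat by lia.
rewrite -(chain_sp_root ji) {1}ji root_vecE.
by rewrite -ji.
Qed.

Lemma odd_sp_val_sum (I : finType) (F : I -> odd_sp K n) :
  odd_sp_val (\sum_i F i) = \sum_i odd_sp_val (F i).
Proof. exact: (big_morph (@odd_sp_val K n) (fun _ _ => erefl) erefl). Qed.

Lemma sp_root_expand (X : odd_sp K n) :
  X = 2%:R^-1 *: \sum_i \sum_j sp_coord X i j *: sp_root i j.
Proof.
apply: val_inj; rewrite linearZ /= odd_sp_val_sum.
(* Symmetrizing the symmetric matrix [sp_coord X] doubles it, and turns each elementary matrix into
   the one defining [sp_root]. *)
transitivity (2%:R^-1 *: sp_of (sp_coord X + (sp_coord X)^T)).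
  rewrite sp_coord_sym ?odd_sp_valP // -mulr2n -scaler_nat linearZ /= scalerA.
  by rewrite mulVf // scale1r sp_coordK ?odd_sp_valP.
congr (_ *: _); rewrite {1 2}[sp_coord X]matrix_sum_delta !linear_sum.
rewrite -big_split linear_sum.
apply: eq_bigr => i _; rewrite !linear_sum -big_split linear_sum odd_sp_val_sum /=.
apply: eq_bigr => j _.
by rewrite [X in sp_of (_ + X)]linearZ /= trmx_delta -scalerDr linearZ.
Qed.

End OddSpModel.

(** * The inverse map and the isomorphism *)

Section Isomorphism.
Context (K : fieldType) (n : nat).
Local Notation m := (2 * n + 1)%N.
Local Notation L := (electrical_A K m).
Hypothesis two_neq0 : 2%:R != 0 :> K.

Definition el_gen : nat -> L := ext0 (@pres_gen K 'I_m (@electrical_rel K m)).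

Lemma el_gen_far i j : (i.+2 <= j)%N -> [lie el_gen i, el_gen j] = 0.
Proof.
move=> ij; have [mj|jm] := leqP m j; first by rewrite [el_gen j]ext0_out ?lie0r.
have im : (i < m)%N by lia.
pose p := Ordinal im; pose q := Ordinal jm.
rewrite /el_gen (_ : i = p) // (_ : j = q) // !ext0_ord.
have := @pres_gen_rel K _ (@electrical_rel K m) _ _ (@ER_far K m p q _).
by apply=> /=; lia.
Qed.

Lemma el_gen_near i j : (i < m)%N -> (j < m)%N -> adjacent i j ->
  [lie el_gen i, [lie el_gen i, el_gen j]] = (- 2%:R) *: el_gen i.
Proof.
move=> im jm ij.
pose p := Ordinal im; pose q := Ordinal jm.
rewrite /el_gen (_ : i = p) // (_ : j = q) // !ext0_ord.
have := @pres_gen_rel K _ (@electrical_rel K m) _ _ (@ER_near K m p q _).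
by apply=> /=; move: ij; rewrite /adjacent; lia.
Qed.

(** The expansion of [sp_root_expand] with [root_vec] in place of [sp_root]. It is defined on all
    matrices, so that linearity reduces [el_of_ad] to elementary ones. *)
Definition el_of (A : 'M[K]_m) : L :=
  2%:R^-1 *: \sum_i \sum_j A i j *: root_vec el_gen i j.

Lemma el_of_linear : linear el_of.
Proof.
move=> a A B; rewrite /el_of scalerA mulrC -scalerA -scalerDr; congr (_ *: _).
rewrite scaler_sumr -big_split; apply: eq_bigr => i _.
rewrite scaler_sumr -big_split; apply: eq_bigr => j _ /=.
by rewrite !mxE scalerDl scalerA.
Qed.

HB.instance Definition _ := GRing.isLinear.Build K _ _ _ el_of el_of_linear.

Lemma el_of_delta i j : el_of (delta_mx i j) = 2%:R^-1 *: root_vec el_gen i j.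
Proof.
rewrite /el_of (bigD1 i) //= [X in _ + X]big1 => [|k ki]; last first.
  by apply: big1 => l _; rewrite mxE (negPf ki) scale0r.
rewrite (bigD1 j) //= big1 => [|l lj]; first by rewrite mxE !eqxx scale1r !addr0.
by rewrite mxE (negPf lj) andbF scale0r.
Qed.

Lemma el_of_ad (k : 'I_m) (B : 'M[K]_m)
    (A := alt K k *: delta_mx k k)
    (G := chain_basis K n *m Omega K n *m (chain_basis K n)^T) :
  el_of (A *m G *m B - B *m G *m A) = [lie el_gen k, el_of B].
Proof.
have adE i j : A *m G *m delta_mx i j - delta_mx i j *m G *m A
  = (adjacent k i)%:R *: delta_mx k j + (adjacent k j)%:R *: delta_mx i k.
  exact: ad_delta.
move: A G adE => A G adE.
rewrite {1 2 3}[B]matrix_sum_delta mulmx_sumr !mulmx_suml -sumrB !linear_sum lie_sumr.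
apply: eq_bigr => i _; rewrite mulmx_sumr !mulmx_suml -sumrB !linear_sum lie_sumr.
apply: eq_bigr => j _; rewrite -scalemxAr -!scalemxAl -scalerBr adE !linearZ lieZr.
congr (_ *: _); rewrite linearD !linearZ /= !el_of_delta lieZr.
rewrite (root_vec_bracket two_neq0 el_gen_far el_gen_near) //.
by rewrite scalerDr !scalerA ![2%:R^-1 * _]mulrC.
Qed.

Lemma electrical_odd_sp_iso : lie_isomorphic L (odd_sp K n).
Proof.
have [f [fM fgen _]] := lie_pres_universal (@sp_gen_rel K n two_neq0).
pose g (X : odd_sp K n) : L := el_of (sp_coord X).
have gD X Y : g (X + Y) = g X + g Y by rewrite /g /= !linearD.
have gZ a X : g (a *: X) = a *: g X .
  by rewrite /g (_ : odd_sp_val (a *: X) = a *: odd_sp_val X) // linearZ linearZ.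
(* Generators are handled by [el_of_ad]. For a bracket of terms, the Jacobi identity reduces to
   acting successively by the two terms, so [X] must stay general. *)
have gB x X : g [lie f x, X] = [lie x, g X].
  elim/quotW: x X; elim=> [k||s IHs t IHt|s IHs|a s IHs|s IHs t IHt] X.
  - rewrite [f _]fgen /g.
    have {1}-> : odd_sp_val [lie sp_gen K k, X]
        = [lie odd_sp_val (sp_gen K k), sp_of (sp_coord X)].
      by rewrite sp_coordK ?odd_sp_valP.
    by rewrite /= sp_of_bracket sp_ofK el_of_ad [el_gen k]ext0_ord.
  - rewrite pi_lie0 linear0 !lie0l -[X in g X](scale0r X).
    by rewrite gZ scale0r.
  - by rewrite pi_lieD linearD !lieDl gD IHs IHt.
  - by rewrite pi_lieN linearN !lieNl -scaleN1r gZ scaleN1r IHs.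
  - by rewrite pi_lieZ linearZ !lieZl gZ IHs.
  - rewrite pi_lieBr fM.
    have br (M : lieAlgType K) (x y z : M) :
        [lie [lie x, y], z] = [lie x, [lie y, z]] - [lie y, [lie x, z]].
      by rewrite (lie_derivation x) addrK.
    by rewrite !br -scaleN1r gD gZ scaleN1r !IHs !IHt !IHs.
have gf : cancel f g.
  elim/quotW; elim=> [k||s IHs t IHt|s IHs|a s IHs|s IHs t IHt].
  - rewrite [f _]fgen /g /= sp_ofK linearZ /= el_of_delta root_vecii scalerA scalerA.
    rewrite mulrA mulfVK // alt_sqr scale1r.
    exact: ext0_ord.
  - by rewrite pi_lie0 linear0 -(scale0r (0 : odd_sp K n)) gZ scale0r.
  - by rewrite pi_lieD linearD gD IHs IHt.
  - by rewrite pi_lieN linearN -scaleN1r gZ scaleN1r IHs.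
  - by rewrite pi_lieZ linearZ gZ IHs.
  (* Although [g] is not known to preserve brackets, [gB] pulls the left factor out of [g]. *)
  - by rewrite pi_lieBr fM gB IHt.
have fext k : f (el_gen k) = ext0 (@sp_gen K n) k.
  by rewrite /el_gen /ext0; case: insub => [i|] /=; [exact: fgen|exact: linear0].
have froot (i j : 'I_m) : f (root_vec el_gen i j) = sp_root K i j.
  rewrite -root_vec_sp // /root_vec; case: eqP => _; rewrite linearZ ?fext //.
  by rewrite /= (chain_morph _ _ fM fext).
(* Applying [f] to the sum defining [g X] gives the expansion of [X] in the [sp_root]'s. *)
have fg : cancel g f.
  move=> X; rewrite [RHS]sp_root_expand // /g /el_of linearZ linear_sum /=.
  congr (_ *: _); apply: eq_bigr => i _; rewrite linear_sum; apply: eq_bigr => j _.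
  by rewrite linearZ /= froot.
by exists f; split=> //; exists g.
Qed.

End Isomorphism.

Theorem theorem2p6 (R : realType) (n : nat) :
  lie_isomorphic (electrical_A R[i] (2 * n + 1)) (odd_sp R[i] n).
Proof. by apply: electrical_odd_sp_iso; rewrite Num.Theory.pnatr_eq0. Qed.
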